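(* Let $D$ be a $b$-Noetherian domain with quotient field $K$. Then: (1) $D$ has Noetherian spectrum. (2) Let $V$ be a valuation overring of $D$. Then, for every (fractional) ideal $I$ of $D$, $IV$ is a principal (fractional) ideal of $V$. In particular, if $V\neq K$ is an essential valuation overring of $D$, then $V$ is a rank 1 discrete valuation domain. (3) Assume, moreover, that $D$ is integrally closed. Then $D$ is a Mori domain.
   Context: Let $D$ be an integral domain with quotient field $K$. An overring of $D$ is a ring $T$ with $D\subseteq T\subseteq K$; a valuation overring is an overring which is a valuation domain. For each nonzero $D$-submodule $E$ of $K$ set $E^b:=\bigcap\{EV \mid V \text{ valuation overring of } D\}$. A quasi-$b$-ideal of $D$ is a nonzero ideal $I$ of $D$ with $I^b\cap D=I$. $D$ is $b$-Noetherian if the ascending chain condition holds on quasi-$b$-ideals of $D$; equivalently, for each nonzero ideal $I$ of $D$ there is a finitely generated ideal $F\subseteq I$ with $F^b=I^b$. An essential valuation overring of $D$ is a valuation overring of the form $D_P$ with $P$ a prime ideal of $D$. $D$ has Noetherian spectrum if $\mathrm{Spec}(D)$ is a Noetherian space in the Zariski topology (equivalently, ACC on radical ideals). $D$ is a Mori domain if the ascending chain condition holds on divisorial ideals, i.e. nonzero ideals $I$ of $D$ with $(D:(D:I))=I$, where $(D:E):=\{x\in K\mid xE\subseteq D\}$. *)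

(* Defs.v *)
From HB Require Import structures.
From mathcomp Require Import all_boot all_order all_algebra.
From mathcomp Require Import all_classical topology.

Set Implicit Arguments.
Unset Strict Implicit.
Unset Printing Implicit Defensive.

Import Order.TTheory GRing.Theory Num.Theory.
Local Open Scope classical_set_scope.
Local Open Scope ring_scope.

(* The quotient field of [D] is [{fraction D}], with canonical embedding
   [tofrac]. Ideals of [D] are sets of type [set D]; overrings and
   [D]-submodules of the quotient field are sets of type [set {fraction D}]. *)

Definition acc (T : Type) (F : set (set T)) : Prop :=
  forall I : nat -> set T, (forall n, F (I n)) ->
    (forall n, I n `<=` I n.+1) ->
    exists N, forall n, (N <= n)%N -> I n = I N.

(* Possibly zero, possibly the whole ring. *)
Definition ideal (R : comNzRingType) (I : set R) : Prop :=
  [/\ I 0, forall x y, I x -> I y -> I (x + y)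
    & forall a x, I x -> I (a * x)].

Definition nonzero (R : nmodType) (E : set R) : Prop := exists2 x, E x & x != 0.

(* [idealr_closed] already requires the ideal to be proper. *)
Definition prime_ideal (R : comNzRingType) (P : set R) : Prop :=
  idealr_closed [in P] /\ prime_idealr_closed [in P].

Record spec (R : comNzRingType) := Spec {
  spec_ideal :> set R;
  spec_prime : prime_ideal spec_ideal
}.

(* Complements of the closed sets V(S) = {P | S is contained in P}. *)
Definition zariski_open (R : comNzRingType) : set (set (spec R)) :=
  [set U | exists S : set R, U = [set P : spec R | ~ S `<=` P]].

Section Zariski.
Variable R : comNzRingType.

Lemma zariski_openT : zariski_open [set: spec R].
Proof.
exists setT; apply/seteqP; split => // P _ /= /(_ 1 I) P1.
by case: (spec_prime P) => -[_ /negP[]]; rewrite inE.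
Qed.

Lemma zariski_openI : setI_closed (@zariski_open R).
Proof.
move=> _ _ [S ->] [T ->].
exists [set x * y | x in S & y in T]; apply/seteqP; split => P /=.
- move=> [SP TP] STP; apply: SP => x Sx; apply: contrapT => Px.
  apply: TP => y Ty; case: (spec_prime P) => _ /(_ x y).
  rewrite !inE => /(_ (STP _ _)) H.
  have /H /orP[] : [set x * y | x in S & y in T] (x * y).
    by exists x => //; exists y.
  + by rewrite inE.
  + by rewrite inE.
- move=> STP; case: (spec_prime P) => -[P0 _ Pl] _.
  have Pm a u : spec_ideal P u -> spec_ideal P (a * u).
    move=> Pu; have := Pl a u 0; rewrite addr0 !inE; apply=> //.
    by move: P0; rewrite inE.
  split=> SP; apply: STP => _ [x Sx [y Ty <-]].
  + by rewrite mulrC; apply/Pm/SP.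
  + exact/Pm/SP.
Qed.

Lemma zariski_open_bigU (J : Type) (f : J -> set (spec R)) :
  (forall i, zariski_open (f i)) -> zariski_open (\bigcup_i f i).
Proof.
move=> /choice[S fS]; exists (\bigcup_i S i); apply/seteqP; split => P /=.
- by move=> [i _]; rewrite fS /= => SP H; apply: SP => x Sx; apply: H; exists i.
- move=> H; apply: contrapT => H'; apply: H => x [i _ Sx].
  apply: contrapT => Px; apply: H'; exists i => //.
  by rewrite fS /= => /(_ _ Sx).
Qed.

End Zariski.

HB.instance Definition _ (R : comNzRingType) := gen_eqMixin (spec R).
HB.instance Definition _ (R : comNzRingType) := gen_choiceMixin (spec R).
HB.instance Definition _ (R : comNzRingType) :=
  isOpenTopological.Build (spec R) (@zariski_openT R) (@zariski_openI R)
    (@zariski_open_bigU R).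

Lemma spec_openE (R : comNzRingType) (U : set (spec R)) :
  open U = zariski_open U.
Proof. by []. Qed.

Definition noetherian_space (T : topologicalType) : Prop := acc (@open T).

Section Domain.
Variable D : idomainType.
Local Notation K := {fraction D}.
Local Notation "x %:F" := (tofrac x).
Implicit Types (I P : set D) (E T V : set K).

Definition submodule E : Prop :=
  [/\ E 0, forall x y, E x -> E y -> E (x + y)
    & forall (a : D) x, E x -> E (a%:F * x)].

(* Possibly zero. *)
Definition fractional_ideal E : Prop :=
  submodule E /\
  exists2 d : D, d != 0 & forall x, E x -> exists a : D, d%:F * x = a%:F.

Definition overring T : Prop :=
  subring_closed [in T] /\ forall a : D, T a%:F.

(* An overring has quotient field [K], so it is a valuation domain as soon as
   it contains [x] or its inverse for every nonzero [x] of [K]. *)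
Definition valuation_overring V : Prop :=
  overring V /\ forall x : K, x != 0 -> V x \/ V x^-1.

(* The product [E T] of additive subgroups: finite sums of products. *)
Definition prodset E T : set K :=
  [set x | exists n (e t : 'I_n -> K),
    [/\ forall i, E (e i), forall i, T (t i) & x = \sum_(i < n) e i * t i]].

Definition bclosure E : set K :=
  \bigcap_(V in valuation_overring) prodset E V.

Definition quasi_b_ideal I : Prop :=
  [/\ ideal I, nonzero I & @tofrac D @^-1` bclosure (@tofrac D @` I) = I].

Definition b_noetherian : Prop := acc quasi_b_ideal.

Definition localization P : set K :=
  [set a%:F / s%:F | a in setT & s in ~` P].

Definition essential_valuation_overring V : Prop :=
  valuation_overring V /\ exists2 P, prime_ideal P & V = localization P.

Definition principal_fractional_ideal V E : Prop :=
  exists a : K, E = [set a * v | v in V].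

Definition principal_ideal V E : Prop :=
  exists2 a : K, V a & E = [set a * v | v in V].

(* [V] is the ring of a valuation of [K] with value group the integers; the
   infinite value at 0 is not represented, [v 0] being irrelevant. *)
Definition rank1_discrete_valuation_domain V : Prop :=
  exists v : K -> int,
    [/\ forall x y, x != 0 -> y != 0 -> v (x * y) = v x + v y,
        forall x y, x != 0 -> y != 0 -> x + y != 0 ->
          Num.min (v x) (v y) <= v (x + y),
        forall n : int, exists2 x, x != 0 & v x = n
      & V = [set x | x = 0 \/ 0 <= v x]].

(* (D : E) *)
Definition colon E : set K :=
  [set x | forall y, E y -> exists a : D, x * y = a%:F].

Definition divisorial_ideal I : Prop :=
  [/\ ideal I, nonzero I
    & colon (colon (@tofrac D @` I)) = @tofrac D @` I].

Definition mori : Prop := acc divisorial_ideal.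

Definition integrally_closed : Prop :=
  forall x : K, integralOver (@tofrac D) x -> exists a : D, x = a%:F.

End Domain.

Arguments b_noetherian : clear implicits.
Arguments mori : clear implicits.
Arguments integrally_closed : clear implicits.

(* Main.v *)
Require Import Defs.
From HB Require Import structures.
From mathcomp Require Import all_boot all_order all_algebra ring.
From mathcomp Require Import all_classical topology.

Set Implicit Arguments.
Unset Strict Implicit.
Unset Printing Implicit Defensive.

Import Order.TTheory GRing.Theory Num.Theory.
Local Open Scope classical_set_scope.
Local Open Scope ring_scope.

Local Notation "x %:F" := (tofrac x).

(** Everything rests on two observations.

    The first is that valuation overrings are plentiful
    ([valuation_extension]): if [A] is an overring and [J] a subset of [A]
    which does not generate the unit ideal of [A], then [A] is contained in a
    valuation overring whose unit ideal is not generated by [J] either.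
    It is used for [A = D[1/x]].  With [J] an ideal [I] of [D], clearing
    denominators shows that every element of [D] in the b-closure of [I] has a
    power in [I] ([bclosure_radical]), so that nonzero intersections of primes
    are quasi-b-ideals; an ascending chain of open sets of the spectrum is an
    ascending chain of such intersections, so the spectrum is Noetherian.  With [J] reduced to
    [1/x], the same computation shows that an element lying in all valuation
    overrings is integral over [D] ([integrally_closed_bigcap]); if [D] is
    integrally closed, then [x I <= D] implies [x I^b <= D], so divisorial
    ideals are quasi-b-ideals, and [D] is a Mori domain.

    The second is that the traces [c V] on [D] of the principal fractional
    ideals of a valuation overring [V] are quasi-b-ideals
    ([quasi_b_valuation]).  Hence the family of the [e V], for [e] ranging in a
    fractional ideal [E], has a maximal member; since the ideals of [V] are
    totally ordered, it contains [E] and equals [E V]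
    ([fractional_ideal_dominating]).  When [V], distinct from [K], is the
    localization of [D] at [P], the generator [p] of [P V] generates the maximal ideal of [V].  The
    chain of the traces of [x p^-n V] shows that no nonzero [x] is divisible by
    all powers of [p], so that [p] is a uniformizer of a discrete valuation
    ([essential_discrete]). *)

(** * Overrings and products of submodules *)

Section QuotientField.
Variable D : idomainType.
Local Notation K := {fraction D}.
Implicit Types (I P : set D) (A B E J V : set K).

Lemma frac_ratio (x : K) : exists a b : D, b != 0 /\ x = a%:F / b%:F.
Proof.
elim/quotW: x => r; exists r.1, r.2; split; first exact: denom_ratioP.
have d0 : (r.2)%:F != 0 :> K by rewrite tofrac_eq0 denom_ratioP.
apply: (mulIf d0); rewrite divfK //.
unlock tofrac; rewrite -[LHS]FracField.pi_mul /FracField.mulf.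
apply/eqmodP; rewrite /= FracField.equivfE.
by rewrite !numden_Ratio ?mulf_neq0 ?denom_ratioP ?oner_neq0 //= !mulr1 mulrC.
Qed.

Lemma overring_frac B (a : D) : overring B -> B a%:F.
Proof. by case. Qed.

Lemma overringB B x y : overring B -> B x -> B y -> B (x - y).
Proof. by case=> -[_ h _] _ Bx By; apply: set_mem; apply: h; exact: mem_set. Qed.

Lemma overringM B x y : overring B -> B x -> B y -> B (x * y).
Proof. by case=> -[_ _ h] _ Bx By; apply: set_mem; apply: h; exact: mem_set. Qed.

Lemma overring0 B : overring B -> B 0.
Proof. by move=> oB; rewrite -(tofrac0 D); exact: overring_frac. Qed.

Lemma overring1 B : overring B -> B 1.
Proof. by move=> oB; rewrite -(tofrac1 D); exact: overring_frac. Qed.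

Lemma overringN B x : overring B -> B x -> B (- x).
Proof.
by move=> oB Bx; rewrite -[- x]add0r; apply: overringB Bx => //; exact: overring0.
Qed.

Lemma overringD B x y : overring B -> B x -> B y -> B (x + y).
Proof.
by move=> oB Bx By; rewrite -[y]opprK; apply: overringB => //; exact: overringN.
Qed.

Lemma overring_sum B (I : Type) (r : seq I) (F : I -> K) :
  overring B -> (forall i, B (F i)) -> B (\sum_(i <- r) F i).
Proof.
move=> oB BF; elim/big_ind: _ => //; first exact: overring0.
by move=> x y; exact: overringD.
Qed.

Lemma overringX B x n : overring B -> B x -> B (x ^+ n).
Proof.
move=> oB Bx; elim: n => [|n IH]; first by rewrite expr0; exact: overring1.
by rewrite exprS; exact: overringM.
Qed.

Lemma overring_range : overring (range (@tofrac D)).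
Proof.
split=> [|a]; last by exists a.
split=> [|x y|x y]; rewrite !inE.
- by exists 1 => //; rewrite tofrac1.
- by move=> [a _ <-] [b _ <-]; exists (a - b) => //; rewrite tofracB.
- by move=> [a _ <-] [b _ <-]; exists (a * b) => //; rewrite tofracM.
Qed.

Lemma prodset_mul E B x y : E x -> B y -> prodset E B (x * y).
Proof.
by move=> Ex By; exists 1%N, (fun=> x), (fun=> y); split => //; rewrite big_ord1.
Qed.

Lemma prodset0 E B : prodset E B 0.
Proof.
by exists 0%N, (fun=> 0), (fun=> 0); split; [case|case|rewrite big_ord0].
Qed.

Lemma prodsetD E B x y :
  prodset E B x -> prodset E B y -> prodset E B (x + y).
Proof.
move=> [n [e [t [Ee Bt ->]]]] [m [e' [t' [Ee' Bt' ->]]]].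
exists (n + m)%N,
  (fun i => match fintype.split i with inl j => e j | inr j => e' j end),
  (fun i => match fintype.split i with inl j => t j | inr j => t' j end).
split=> [i|i|]; try by case: (fintype.split i).
rewrite big_split_ord /=; congr (_ + _); apply: eq_bigr => i _.
- by rewrite -[lshift m i]/(unsplit (inl i)) unsplitK.
- by rewrite -[rshift n i]/(unsplit (inr i)) unsplitK.
Qed.

Lemma prodset_sum E B (I : Type) (r : seq I) (F : I -> K) :
  (forall i, prodset E B (F i)) -> prodset E B (\sum_(i <- r) F i).
Proof.
move=> EF; elim/big_ind: _ => //; first exact: prodset0.
by move=> x y; exact: prodsetD.
Qed.

Lemma prodsetMr E B b x :
  overring B -> B b -> prodset E B x -> prodset E B (b * x).
Proof.
move=> oB Bb [n [e [t [Ee Bt ->]]]]; exists n, e, (fun i => b * t i).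
split=> // [i|]; first exact: overringM.
by rewrite mulr_sumr; apply: eq_bigr => i _; rewrite mulrCA.
Qed.

Lemma prodset_contains E B : overring B -> E `<=` prodset E B.
Proof.
by move=> oB x Ex; rewrite -[x]mulr1; apply: prodset_mul => //; exact: overring1.
Qed.

Lemma prodset_sub_principal E B c :
  overring B -> E `<=` [set c * v | v in B] ->
  prodset E B `<=` [set c * v | v in B].
Proof.
move=> oB EcB x [n [e [t [Ee Bt ->]]]].
have /choice[w /all_and2[Bw wE]] : forall i, exists w, B w /\ c * w = e i.
  by move=> i; have [w Bw wE] := EcB _ (Ee i); exists w.
exists (\sum_(i < n) w i * t i).
  by apply: overring_sum => // i; exact: overringM.
by rewrite mulr_sumr; apply: eq_bigr => i _; rewrite mulrA wE.
Qed.

Lemma prodset_range_ideal I : ideal I ->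
  prodset (@tofrac D @` I) (range (@tofrac D)) `<=` @tofrac D @` I.
Proof.
move=> [I0 ID IM] x [n [e [t [Ee Bt ->]]]].
elim/big_ind: _ => [|u w [a Ia <-] [b Ib <-]|i _].
- by exists 0 => //; rewrite tofrac0.
- by exists (a + b); [exact: ID|rewrite tofracD].
- have [a Ia <-] := Ee i; have [b _ <-] := Bt i.
  by exists (b * a); [exact: IM|rewrite tofracM mulrC].
Qed.

(** * Existence of valuation overrings *)

Definition adjoin B x : set K :=
  [set y | exists2 q : {poly K}, forall i, B q`_i & y = q.[x]].

Lemma adjoin_contains B x : overring B -> B `<=` adjoin B x.
Proof.
move=> oB b Bb; exists b%:P; last by rewrite hornerC.
by move=> i; rewrite coefC; case: ifP => // _; exact: overring0.
Qed.

Lemma adjoin_gen B x : overring B -> adjoin B x x.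
Proof.
move=> oB; exists 'X; last by rewrite hornerX.
by move=> i; rewrite coefX; case: (_ == _); [exact: overring1|exact: overring0].
Qed.

Lemma overring_adjoin B x : overring B -> overring (adjoin B x).
Proof.
move=> oB; split=> [|a]; last by apply: adjoin_contains => //; exact: overring_frac.
split=> [|y z|y z]; rewrite !inE.
- by apply: adjoin_contains => //; exact: overring1.
- move=> [p Bp ->] [q Bq ->]; exists (p - q); last by rewrite !hornerE.
  by move=> i; rewrite coefB; exact: overringB.
- move=> [p Bp ->] [q Bq ->]; exists (p * q); last by rewrite hornerM.
  move=> i; rewrite coefM; apply: overring_sum => // j; exact: overringM.
Qed.

Lemma prodset_adjoin J B x y : prodset J (adjoin B x) y ->
  exists2 q : {poly K}, forall i, prodset J B q`_i & y = q.[x].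
Proof.
move=> [n [e [t [Je Bt ->]]]].
have /choice[q' /all_and2[Bq' tE]] : forall i, exists q : {poly K},
    (forall k, B q`_k) /\ t i = q.[x].
  by move=> i; have [u Bu ->] := Bt i; exists u.
exists (\sum_(i < n) e i *: q' i).
  move=> k; rewrite coef_sum; apply: prodset_sum => i; rewrite coefZ.
  exact: prodset_mul.
by rewrite horner_sum; apply: eq_bigr => i _; rewrite hornerZ tE.
Qed.

(** Clearing denominators in [x^-1]; the bound [n] on the degree need not be
    sharp, so that two relations can be brought to the same degree. *)
Lemma horner_inv (q : {poly K}) x n : x != 0 -> (size q <= n.+1)%N ->
  x ^+ n * q.[x^-1] = \sum_(i < n.+1) q`_i * x ^+ (n - i).
Proof.
move=> x0 sq; rewrite (horner_coef_wide _ sq) mulr_sumr.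
apply: eq_bigr => i _; rewrite mulrCA exprVn -expfB_cond //.
by rewrite (negPf x0) add0n -ltnS.
Qed.

(** Two relations [1 = p(x)] and [1 = q(1/x)], both of degree at most [n + 1]
    and with coefficients in the ideal [J B], allow the degree of the first one
    to be lowered.  Write [q0] for the constant term of [q] and [a] for the top
    coefficient of [p].  Multiplying the second relation by [a x^(n + 1)]
    expresses [(1 - q0) a x^(n + 1)] in lower powers of [x]; substituting this
    in [1 = q0 + (1 - q0) p(x)] removes the top term.  Multiplying by [1 - q0]
    instead of inverting it avoids reducing to a local ring. *)
Lemma unit_relation_reduce J B x n (p q : {poly K}) :
  overring B -> J `<=` B -> x != 0 ->
  (forall i, prodset J B p`_i) -> (forall i, prodset J B q`_i) ->
  (size p <= n.+2)%N -> p.[x] = 1 -> (size q <= n.+2)%N -> q.[x^-1] = 1 ->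
  exists r : {poly K}, [/\ forall i, prodset J B r`_i,
    (size r <= n.+1)%N & r.[x] = 1].
Proof.
move=> oB JB x0 Jp Jq sp px sq qx.
have JBB y : prodset J B y -> B y.
  move=> [k [e [t [Je Bt ->]]]]; apply: overring_sum => // i.
  by apply: overringM => //; exact: JB.
pose c i := q`_0 *+ (i == 0)%N + (1 - q`_0) * p`_i + p`_n.+1 * q`_(n.+1 - i).
exists (\poly_(i < n.+1) c i); split; last 2 first.
- exact: size_poly.
- rewrite horner_poly /c.
  under eq_bigr do rewrite 2!mulrDl -!mulrA.
  rewrite !big_split /= -!mulr_sumr.
  have -> : \sum_(i < n.+1) q`_0 *+ (i == 0 :> nat) * x ^+ i = q`_0.
    by rewrite big_ord_recl /= expr0 mulr1 big1 ?addr0 // => i _; rewrite mul0r.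
  have -> : \sum_(i < n.+1) p`_i * x ^+ i = 1 - p`_n.+1 * x ^+ n.+1.
    by rewrite -px (horner_coef_wide _ sp) [in RHS]big_ord_recr addrK.
  have -> : \sum_(i < n.+1) q`_(n.+1 - i) * x ^+ i = (1 - q`_0) * x ^+ n.+1.
    rewrite mulrBl mul1r -[X in X - _]mulr1 -qx (horner_inv x0 sq).
    rewrite [X in X - _]big_ord_recl /= subn0 [_ + \sum_(i < _) _]addrC addrK.
    rewrite (reindex_inj rev_ord_inj) /=.
    apply: eq_bigr => i _; rewrite /bump /= add1n subSS; congr (_`_ _ * _).
    by rewrite subSn ?leq_subr // subKn ?leq_ord //.
  by ring.
move=> i; rewrite coef_poly; case: ifP => _; last exact: prodset0.
apply: prodsetD; first apply: prodsetD.
- by case: (i == 0)%N; [exact: Jq|exact: prodset0].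
- apply: prodsetMr => //; apply: overringB => //; first exact: overring1.
  exact/JBB/Jq.
- by apply: prodsetMr => //; exact/JBB/Jp.
Qed.

(** Descent on the sum of the two degrees: [unit_relation_reduce] applies to
    the longer relation, and the hypotheses are symmetric in [x] and [x^-1].
    When a relation has degree [0], it says that [1] itself is in [J B]. *)
Lemma unit_relation_pair J B x (p q : {poly K}) :
  overring B -> J `<=` B -> x != 0 ->
  (forall i, prodset J B p`_i) -> (forall i, prodset J B q`_i) ->
  p.[x] = 1 -> q.[x^-1] = 1 -> prodset J B 1.
Proof.
move=> oB JB; have [k] := ubnP (size p + size q).
elim: k x p q => // k IH x p q spq x0 Jp Jq px qx.
wlog sqp : x p q spq x0 Jp Jq px qx / (size q <= size p)%N => [hwlog|].
  have [qp|/ltnW pq] := leqP (size q) (size p); first exact: (hwlog x p q).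
  by apply: (hwlog x^-1 q p) => //; rewrite ?invrK ?invr_eq0 // addnC.
have [sp1|sp1] := leqP (size p) 1.
  by move: (Jp 0); rewrite -px (size1_polyC sp1) hornerC coefC.
have sp : size p = (size p).-2.+2 by case: (size p) sp1 => [|[]].
have [r [Jr sr rx]] := unit_relation_reduce oB JB x0 Jp Jq (eq_leq sp) px
  (leq_trans sqp (eq_leq sp)) qx.
apply: (IH x r q) => //; rewrite -ltnS; apply: leq_trans spq.
by rewrite ltnS ltn_add2r sp ltnS.
Qed.

(** By Zorn's lemma, take [B] maximal among the overrings containing [A] and
    with [1] outside [J B].  If neither [x] nor [x^-1] were in [B], then by
    maximality [1] would be in both [J B[x]] and [J B[x^-1]], which
    [unit_relation_pair] excludes. *)
Lemma valuation_extension A J : overring A -> J `<=` A -> ~ prodset J A 1 ->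
  exists V, [/\ valuation_overring V, A `<=` V & ~ prodset J V 1].
Proof.
move=> oA JA JA1.
pose good B := [/\ overring B, A `<=` B & ~ prodset J B 1].
(* The empty set is admitted so that the empty chain has a bound. *)
have [|B [goodB maxB]] := @Zorn_bigcup K [set B | B = set0 \/ good B].
  move=> F Fgood Ftot; have [Fg|Fno] := pselect (exists2 B, F B & good B); last first.
    left; apply/seteqP; split=> // x [B FB Bx].
    by case: (Fgood _ FB) => [B0|gB]; [rewrite -B0|case: Fno; exists B].
  have [B0 FB0 gB0] := Fg; have [oB0 AB0 _] := gB0; right.
  have memF B x : F B -> B x -> good B.
    by move=> FB Bx; case: (Fgood _ FB) => // B_0; rewrite B_0 in Bx.
  have common n (t : 'I_n -> K) : (forall i, (\bigcup_(X in F) X) (t i)) ->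
      exists2 B, F B /\ good B & forall i, B (t i).
    elim: n t => [|n IH] t Ft; first by exists B0 => [|[]].
    have [B [FB gB] Bt] := IH (fun i => t (lift ord0 i)) (fun i => Ft _).
    have [C FC Ct] := Ft ord0; have gC := memF _ _ FC Ct.
    case: (Ftot _ _ FB FC) => [BC|CB].
    - by exists C => // i; case: (unliftP ord0 i) => [j|] -> //; exact/BC.
    - by exists B => // i; case: (unliftP ord0 i) => [j|] -> //; exact/CB.
  have pair x y : (\bigcup_(X in F) X) x -> (\bigcup_(X in F) X) y ->
      exists B, [/\ F B, good B, B x & B y].
    move=> Fx Fy; have [|B [FB gB] Bt] :=
      common 2%N (fun i => if i == ord0 then x else y).
      by move=> i; case: (i == ord0).
    by exists B; split=> //; [have := Bt ord0|have := Bt ord_max].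
  split.
  - split=> [|a]; last by exists B0 => //; exact: overring_frac.
    split=> [|x y|x y]; rewrite !inE.
    + by exists B0 => //; exact: overring1.
    + move=> /pair h /h[B [FB [oB _ _] Bx By]]; exists B => //.
      exact: overringB.
    + move=> /pair h /h[B [FB [oB _ _] Bx By]]; exists B => //.
      exact: overringM.
  - by move=> x Ax; exists B0 => //; exact: AB0.
  - move=> [n [e [t [Je /common[B [FB [_ _ JB1]] Bt] E]]]].
    by apply: JB1; exists n, e, t.
have {goodB} [oB AB JB1] : good B.
  case: goodB => // B0; exfalso; apply: (maxB A); last by right; split.
  by rewrite B0; split=> // /(_ _ (overring1 oA)).
exists B; split=> //; split=> // x x0; apply: contrapT => /not_orP[Bx BxV].
have big y : ~ B y -> exists2 q : {poly K},
    forall i, prodset J B q`_i & 1 = q.[y].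
  move=> By; apply: prodset_adjoin; apply: contrapT => Jy1.
  apply: (maxB (adjoin B y)).
    split; first exact: adjoin_contains.
    by move=> /(_ _ (adjoin_gen y oB)).
  right; split=> //; first exact: overring_adjoin.
  by apply: subset_trans AB _; exact: adjoin_contains.
have [p Jp px] := big _ Bx; have [q Jq qx] := big _ BxV.
by apply: JB1; apply: (unit_relation_pair oB _ x0 Jp Jq) => // y /JA /AB.
Qed.

(** If no power of [x] is in [I], then [I] does not generate the unit ideal of
    [D[1/x]], for a relation [1 = q(1/x)] with coefficients in [I] gives a power
    of [x] in [I] once denominators are cleared.  A valuation overring [V]
    containing [1/x] with [1] outside [I V] cannot have [x] in [I V]. *)
Lemma bclosure_radical I (x : D) : ideal I ->
  bclosure (@tofrac D @` I) x%:F -> exists n, I (x ^+ n).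
Proof.
move=> idI Ibx; have [I0 ID IM] := idI.
have [->|x0] := eqVneq x 0; first by exists 1%N; rewrite expr1.
have xF0 : x%:F != 0 by rewrite tofrac_eq0.
apply: contrapT => /forallNP Ix; have oD := overring_range.
have oA := overring_adjoin (x%:F)^-1 oD.
have [||V [vV AV IV1]] := valuation_extension (J := @tofrac D @` I) oA.
- by move=> _ [a _ <-]; exact: overring_frac.
- move=> /prodset_adjoin[q Iq q1]; apply: (Ix (size q)).
  suff [a Ia /eqP] : (@tofrac D @` I) (x%:F ^+ size q).
    by rewrite -tofracXn tofrac_eq => /eqP <-.
  apply: prodset_range_ideal => //.
  rewrite -[_ ^+ _]mulr1 q1 (horner_inv xF0 (leqnSn _)).
  apply: prodset_sum => i; rewrite mulrC; apply: prodsetMr => //.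
  by apply: overringX => //; exists x.
have [oV _] := vV; apply: IV1; rewrite -(mulVf xF0); apply: prodsetMr => //.
  exact/AV/adjoin_gen.
exact: Ibx.
Qed.

(** An integrally closed domain is the intersection of its valuation overrings.
    If [x] is not integral, then [1/x] is not a unit of [D[1/x]], because
    [1 = (1/x) c(1/x)] becomes a monic equation for [x] once multiplied by a
    power of [x].  A valuation overring in which [1/x] is still not a unit does
    not contain [x]. *)
Lemma integrally_closed_bigcap : integrally_closed D -> forall x : K,
  (forall V, valuation_overring V -> V x) -> exists a : D, x = a%:F.
Proof.
move=> icD x Vx; have [->|x0] := eqVneq x 0; first by exists 0; rewrite tofrac0.
apply: icD; apply: contrapT => nint; have oD := overring_range.
have oA := overring_adjoin x^-1 oD.
have [||V [vV AV JV1]] := valuation_extension (J := [set x^-1]) oA.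
- by move=> _ ->; exact: adjoin_gen.
- move=> /prodset_adjoin[q Jq q1]; apply: nint.
  have /choice[c qE] : forall i, exists a : D, q`_i = x^-1 * a%:F.
    move=> i; have [k [e [t [Je Bt ->]]]] := Jq i.
    have /choice[a tE] : forall j, exists b : D, t j = b%:F.
      by move=> j; have [b _ <-] := Bt j; exists b.
    exists (\sum_(j < k) a j); rewrite rmorph_sum mulr_sumr.
    by apply: eq_bigr => j _; rewrite Je tE.
  set n := size q; pose r : {poly D} := \sum_(i < n.+1) c i *: 'X^(n - i).
  have sr : (size (- r)%R < size ('X^(n.+1) : {poly D})%R)%N.
    rewrite size_polyN size_polyXn ltnS; apply: leq_trans (size_sum _ _ _) _.
    apply/bigmax_leqP => i _; apply: leq_trans (size_scale_leq _ _) _.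
    by rewrite size_polyXn ltnS leq_subr.
  exists ('X^(n.+1) - r); first by rewrite monicE lead_coefDl // lead_coefXn.
  apply/rootP; rewrite rmorphB rmorph_sum /= hornerD hornerN horner_sum.
  rewrite map_polyXn hornerXn; apply/eqP; rewrite subr_eq0; apply/eqP.
  rewrite exprS -[X in _ * X]mulr1 q1 (horner_inv x0 (leqnSn _)) mulr_sumr.
  apply: eq_bigr => i _; rewrite map_polyZ map_polyXn hornerZ hornerXn qE.
  by rewrite mulrA mulVKf.
apply: JV1; rewrite -(mulVf x0); apply: prodset_mul => //; exact: Vx.
Qed.
End QuotientField.

(** * Noetherian spectrum *)

Section PrimeIdeals.
Variables (R : comNzRingType) (P : set R).
Hypothesis primeP : prime_ideal P.

Lemma prime_ideal_ideal : ideal P.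
Proof.
have [[P0 _ PL] _] := primeP; rewrite inE in P0.
have PL' a x y : P x -> P y -> P (a * x + y).
  by move=> Px Py; apply: set_mem; apply: PL; exact: mem_set.
split=> // [x y Px Py|a x Px]; first by rewrite -[x]mul1r; exact: PL'.
by rewrite -[_ * _]addr0; exact: PL'.
Qed.

Lemma prime_ideal1 : ~ P 1.
Proof. by have [[_ /negP P1 _] _] := primeP; move=> /mem_set. Qed.

Lemma prime_idealM x y : P (x * y) -> P x \/ P y.
Proof.
have [_ h] := primeP; move=> /mem_set/h/orP[] /set_mem; first by left.
by right.
Qed.

Lemma prime_idealX x n : P (x ^+ n) -> P x.
Proof.
elim: n => [/prime_ideal1 //|n IH]; rewrite exprS => /prime_idealM[] //.
Qed.

End PrimeIdeals.

Section BNoetherian.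
Variable D : idomainType.
Local Notation K := {fraction D}.
Implicit Types (I P : set D) (E V : set K).

Lemma valuation_overring_overring V : valuation_overring V -> overring V.
Proof. by case. Qed.

Lemma quasi_b_idealI I : ideal I -> nonzero I ->
  (forall x : D, bclosure (@tofrac D @` I) x%:F -> I x) -> quasi_b_ideal I.
Proof.
move=> idI I0 Ib; split=> //; apply/seteqP; split=> x; first exact: Ib.
by move=> Ix V [oV _]; apply: prodset_contains => //; exists x.
Qed.

(** By [bclosure_radical], since an intersection of primes is a radical
    ideal. *)
Lemma quasi_b_bigcap_prime (F : set (spec D)) :
  let I := [set x | forall P : spec D, F P -> spec_ideal P x] in
  nonzero I -> quasi_b_ideal I.
Proof.
move=> I I0; have idP (P : spec D) := prime_ideal_ideal (spec_prime P).
apply: quasi_b_idealI => // [|x Ix P FP].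
  split=> [P _|x y Ix Iy P FP|a x Ix P FP]; have [P0 PD PM] := idP P => //.
  - by apply: PD; [exact: Ix|exact: Iy].
  - by apply: PM; exact: Ix.
have [n Pxn] : exists n, spec_ideal P (x ^+ n).
  apply: bclosure_radical => // V vV; have [n [e [t [Ie Vt ->]]]] := Ix V vV.
  exists n, e, t; split=> // i; have [a Ia <-] := Ie i.
  by exists a => //; exact: Ia.
exact: prime_idealX (spec_prime P) _ _ Pxn.
Qed.

(** An open set [U] is determined by the intersection [I] of the primes outside
    [U]: a prime is in [U] exactly when it does not contain [I].  Only nonzero
    ideals can be quasi-b-ideals, so the chain of the [I n] is examined from the
    first nonzero one on; if there is none, it is constant. *)
Lemma b_noetherian_spec : b_noetherian D -> noetherian_space (spec D).
Proof.
move=> hD U oU Uincr.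
pose I n := [set x | forall P : spec D, (~` U n) P -> spec_ideal P x].
have UI n (P : spec D) : U n P <-> ~ (I n `<=` P).
  split=> [UnP InP|]; last by move=> InP; apply: contrapT => nU; apply: InP => x; exact.
  have [S UE] := oU n; move: (UnP); rewrite UE; apply=> x Sx.
  apply: InP => Q; rewrite /= UE => /contrapT SQ; exact: SQ.
have IU n m : I n = I m -> U n = U m.
  by move=> InIm; apply/seteqP; split=> P /UI h; apply/UI; [rewrite -InIm|rewrite InIm].
have I0 n : I n 0 by move=> P _; case: (prime_ideal_ideal (spec_prime P)).
have Iincr n : I n `<=` I n.+1.
  by move=> x Ix P nU; apply: Ix; move=> /Uincr.
have [[n0 In0]|allz] := pselect (exists n, nonzero (I n)); last first.
  exists 0%N => n _; apply: IU; apply/seteqP; split=> x Ix.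
  - have [->|x0] := eqVneq x 0; first exact: I0.
    by case: allz; exists n, x.
  - have [->|x0] := eqVneq x 0; first exact: I0.
    by case: allz; exists 0%N, x.
have Inz n : nonzero (I (n + n0)%N).
  elim: n => // n [x Ix x0]; exists x => //; exact: Iincr.
have [||N IN] := hD (fun n => I (n + n0)%N).
- by move=> n; exact: (quasi_b_bigcap_prime (Inz n)).
- by move=> n; exact: Iincr.
exists (N + n0)%N => n Nn; apply: IU.
have n0n : (n0 <= n)%N by apply: leq_trans Nn; exact: leq_addl.
by rewrite -(subnK n0n); apply: IN; rewrite leq_subRL // addnC.
Qed.

(** * Extension of ideals to valuation overrings *)

(** The trace [I] of [c V] satisfies [I^b <= I V <= c V]. *)
Lemma quasi_b_valuation V (c : K) : valuation_overring V -> c != 0 ->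
  quasi_b_ideal (@tofrac D @^-1` [set c * v | v in V]).
Proof.
move=> vV c0; have oV := valuation_overring_overring vV.
apply: quasi_b_idealI => [||x /(_ V vV)].
- split=> [|x y [u Vu uE] [v Vv vE]|a x [u Vu uE]].
  + by exists 0; [exact: overring0|rewrite mulr0 tofrac0].
  + by exists (u + v); [exact: overringD|rewrite mulrDr uE vE tofracD].
  + exists (a%:F * u); last by rewrite mulrCA uE tofracM.
    by apply: overringM => //; exact: overring_frac.
- have [a [b [b0 cE]]] := frac_ratio c; rewrite -(tofrac_eq0 b) in b0.
  exists a; last by apply: contraNneq c0 => a0; rewrite cE a0 tofrac0 mul0r.
  by exists b%:F; [exact: overring_frac|rewrite cE divfK].
- by apply: prodset_sub_principal => // _ [a cVa <-].
Qed.

(** If no [e V] with [e] in [E] contains [E], one can choose a sequence [u] in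
    [E] with [u n.+1] outside [u n V].  As [V] is a valuation ring, the [u n V]
    then increase strictly.  For a common denominator [d] of [E], the traces on
    [D] of the [d (u n) V] contain the elements [d (u n)] of [D], so they also
    increase strictly, against the chain condition. *)
Lemma fractional_ideal_dominating V E : b_noetherian D ->
  valuation_overring V -> fractional_ideal E ->
  exists2 e, E e & E `<=` [set e * v | v in V].
Proof.
move=> hD vV [[E0 _ _] [d d0 Ed]]; have oV := valuation_overring_overring vV.
apply: contrapT => noe.
have /choice[f fP] : forall e, exists e',
    E e -> E e' /\ ~ [set e * v | v in V] e'.
  move=> e; have [Ee|nEe] := pselect (E e); last by exists e.
  apply: contrapT => H; apply: noe; exists e => // e' Ee'.
  by apply: contrapT => ne'; apply: H; exists e'.
have f0 e : E e -> f e != 0.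
  move=> /fP[_ ne]; apply: contra_notN ne => /eqP ->.
  by exists 0; [exact: overring0|rewrite mulr0].
(* The sequence starts at [f 0], which is nonzero since it is not in [0 V]. *)
pose u n := iter n.+1 f 0.
have Eu n : E (u n) by elim: n => [|n IH]; [case: (fP _ E0)|case: (fP _ IH)].
have u0 n : u n != 0.
  by case: n => [|n]; rewrite /u iterS; apply: f0 => //; exact: Eu.
have uV n : ~ V (u n.+1 / u n).
  have [_ nu] := fP _ (Eu n) => Vu; apply: nu.
  by exists (u n.+1 / u n) => //; rewrite mulrC divfK.
have dF0 : d%:F != 0 by rewrite tofrac_eq0.
have [||N IN] := hD (fun n => @tofrac D @^-1` [set d%:F * u n * v | v in V]).
- by move=> n; apply: quasi_b_valuation => //; rewrite mulf_neq0.
- move=> n a [v Vv vE]; exists (u n / u n.+1 * v).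
    apply: overringM => //; rewrite -invf_div.
    have [||//] := vV.2 (u n.+1 / u n); last by move=> /uV.
    by rewrite mulf_neq0 ?invr_eq0.
  rewrite -vE -!mulrA; congr (_ * _).
  by rewrite mulrCA; congr (_ * _); rewrite mulVKf.
have [a aE] := Ed _ (Eu N.+1); have /seteqP[IN1 _] := IN N.+1 (leqnSn N).
have [|v Vv vE] := IN1 a.
  by exists 1; [exact: overring1|rewrite mulr1].
apply: (uV N); suff -> : u N.+1 / u N = v by [].
by apply: (mulfI (u0 N)); rewrite mulrC divfK //; apply: (mulfI dF0); rewrite mulrA vE.
Qed.

Lemma prodset_dominated V E e : overring V -> E e ->
  E `<=` [set e * v | v in V] -> prodset E V = [set e * v | v in V].
Proof.
move=> oV Ee EeV; apply/seteqP; split; first exact: prodset_sub_principal.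
by move=> _ [v Vv <-]; exact: prodset_mul.
Qed.

Lemma ideal_fractional I : ideal I -> fractional_ideal (@tofrac D @` I).
Proof.
move=> [I0 ID IM]; split; last first.
  by exists 1; [exact: oner_neq0|move=> _ [a _ <-]; exists a; rewrite tofrac1 mul1r].
split=> [|_ _ [a Ia <-] [b Ib <-]|c _ [a Ia <-]].
- by exists 0; rewrite ?tofrac0.
- by exists (a + b); [exact: ID|rewrite tofracD].
- by exists (c * a); [exact: IM|rewrite tofracM].
Qed.

(** * Essential valuation overrings *)

(** The value of [x] is the integer [n] for which [x t^-n] is a unit of [V].
    For [x] in [V] it is the last [n] with [x / t^n] in [V], and the elements of
    [K] outside [V] are treated by inversion.  That [n] is also the largest
    integer [m] with [x t^-m] in [V] ([leU] below), which gives its uniqueness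
    and the ultrametric inequality. *)
Lemma uniformizer_discrete V (t : K) : valuation_overring V ->
  V t -> t != 0 -> ~ V t^-1 ->
  (forall x, V x -> x != 0 -> V x^-1 \/ V (x / t)) ->
  (forall x, x != 0 -> exists n : nat, ~ V (x / t ^+ n)) ->
  rank1_discrete_valuation_domain V.
Proof.
move=> vV Vt t0 nVt unit_or arch; have oV := valuation_overring_overring vV.
have tz0 n : t ^ n != 0 by rewrite expfz_neq0.
have Vtz (n : int) : 0 <= n -> V (t ^ n).
  by case: n => // n _; exact: overringX.
have tzV (n : int) : V (t ^ n) -> 0 <= n.
  case: n => // n Vn; exfalso; apply: nVt.
  rewrite -[t^-1](_ : t ^ Negz n * t ^+ n = _); last first.
    by rewrite /exprz exprS invfM divfK // expf_neq0.
  by apply: overringM => //; exact: overringX.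
pose U x (n : int) := V (x * t ^ (- n)) /\ V (x * t ^ (- n))^-1.
have leU x (n m : int) : x != 0 -> V (x * t ^ (- m)) -> U x n -> m <= n.
  move=> x0 Vm [_ Vn]; rewrite -subr_ge0; apply: tzV.
  suff -> : t ^ (n - m) = x * t ^ (- m) * (x * t ^ (- n))^-1 by exact: overringM.
  rewrite invfM invr_expz opprK mulrACA divff // mul1r -expfzDr //.
  by congr (_ ^ _); rewrite addrC.
have uniqU x (n m : int) : x != 0 -> U x n -> U x m -> n = m.
  move=> x0 Un Um; apply/eqP; rewrite eq_le.
  by rewrite (leU _ _ _ x0 Un.1 Um) (leU _ _ _ x0 Um.1 Un).
have VU x : V x -> x != 0 -> exists n, U x n.
  move=> Vx x0.
  have ex : exists n : nat, `[< ~ V (x / t ^+ n) >].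
    by have [n Vn] := arch x x0; exists n; apply/asboolP.
  case: (ex_minnP ex) => -[|n] /asboolP nVn minn.
    by case: nVn; rewrite expr0 divr1.
  exists (n%:Z); rewrite /U -invr_expz -[t ^ n]/(t ^+ n).
  have Vn : V (x / t ^+ n).
    apply: contrapT => nV; suff: (n.+1 <= n)%N by rewrite ltnn.
    by apply: minn; apply/asboolP.
  split=> //; have [] // := unit_or _ Vn.
    by rewrite mulf_neq0 ?invr_eq0 ?expf_neq0.
  by rewrite -mulrA -invfM -exprSr => /nVn.
have exU x : exists n, x != 0 -> U x n.
  have [->|x0] := eqVneq x 0; first by exists 0.
  case: (vV.2 x x0) => [/VU/(_ x0)[n Un]|/VU]; first by exists n.
  rewrite invr_eq0 => /(_ x0)[n [Vn Vn']]; exists (- n) => _.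
  have -> : x = x^-1^-1 by rewrite invrK.
  by split; [rewrite -invr_expz -invfM|rewrite -invr_expz -invfM invrK].
have [v vP] := choice exU.
have Vle x m : x != 0 -> m <= v x -> V (x * t ^ (- m)).
  move=> x0 mv; have -> : x * t ^ (- m) = x * t ^ (- v x) * t ^ (v x - m).
    by rewrite -mulrA -expfzDr // addKr.
  by apply: overringM (vP _ x0).1 _ => //; apply: Vtz; rewrite subr_ge0.
exists v; split=> [x y x0 y0|x y x0 y0 xy0|n|].
- apply: (uniqU (x * y)); rewrite ?mulf_neq0 //; first by apply: vP; rewrite mulf_neq0.
  have [Vx Vx'] := vP x x0; have [Vy Vy'] := vP y y0.
  by rewrite /U opprD expfzDr // mulrACA invfM; split; exact: overringM.
- apply: (leU _ _ _ xy0 _ (vP _ xy0)); rewrite mulrDl.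
  by apply: overringD => //; apply: Vle => //; rewrite ge_min lexx ?orbT.
- exists (t ^ n) => //; apply: (uniqU (t ^ n)) (vP _ _) _ => //.
  by rewrite /U -expfzDr // subrr expr0z invr1; split; exact: overring1.
- apply/seteqP; split=> x /=.
    have [->|x0] := eqVneq x 0; first by left.
    by move=> Vx; right; apply: leU (vP _ x0) => //; rewrite oppr0 expr0z mulr1.
  move=> [->|vx]; first exact: overring0.
  have [->|x0] := eqVneq x 0; first exact: overring0.
  by have := Vle x 0 x0 vx; rewrite oppr0 expr0z mulr1.
Qed.

(** The uniformizer is the generator [p] of [P V].  It is nonzero because [V] is
    not the quotient field, it is not a unit because [p] is in [P], and the
    elements of [V] which it does not divide are fractions with numerator
    outside [P], hence units.  If [x] were divisible by all powers of [p], the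
    traces on [D] of the [x / p^n V] would stabilize at some [N]; they generate
    these ideals since [V] is a localization of [D], so [p] would be a unit. *)
Lemma essential_discrete V : b_noetherian D ->
  essential_valuation_overring V -> V <> [set: K] ->
  rank1_discrete_valuation_domain V.
Proof.
move=> hD [vV [P primeP VE]] VT; have oV := valuation_overring_overring vV.
have idP := prime_ideal_ideal primeP; have [P0 PD PM] := idP.
have VP x : V x -> exists a s, [/\ ~ P s, s%:F != 0 & x = a%:F / s%:F].
  rewrite VE => -[a _ [s Ps <-]]; exists a, s; split=> //.
  by rewrite tofrac_eq0; apply: contra_notN Ps => /eqP ->.
have Vinv s : ~ P s -> V (s%:F)^-1.
  by move=> Ps; rewrite VE; exists 1 => //; exists s => //; rewrite tofrac1 mul1r.
have [_ [p Pp <-] PpV] :=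
  fractional_ideal_dominating hD vV (ideal_fractional idP).
have p0 : p%:F != 0.
  apply/eqP => p0; apply: VT; apply/seteqP; split=> // x _.
  have [a [b [b0 ->]]] := frac_ratio x; apply: overringM => //.
    exact: overring_frac.
  apply: Vinv => Pb; have [|v _] := PpV b%:F; first by exists b.
  by rewrite p0 mul0r => /esym/eqP; rewrite tofrac_eq0 (negPf b0).
have nVp : ~ V (p%:F)^-1.
  move=> /VP[a [s [Ps s0 E]]]; apply: Ps; suff -> : s = a * p by exact: PM.
  apply/eqP; rewrite -tofrac_eq tofracM; apply/eqP.
  by apply: (mulIf (invr_neq0 p0)); rewrite mulfK // E mulrC divfK.
apply: (uniformizer_discrete vV (overring_frac p oV) p0 nVp) => [x Vx x0|x x0].
  have [a [s [Ps s0 xE]]] := VP _ Vx; have [Pa|Pa] := pselect (P a); last first.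
    left; rewrite xE invf_div; apply: overringM => //; last exact: Vinv.
    exact: overring_frac.
  right; have [|v Vv vE] := PpV a%:F; first by exists a.
  have -> : x / p%:F = v / s%:F by rewrite xE -vE mulrAC -!mulrA mulrCA mulVKf //.
  by apply: overringM => //; exact: Vinv.
apply: contrapT => /forallNP Vall.
have {}Vall n : V (x / p%:F ^+ n) by apply: contrapT; exact: Vall.
have pX0 n : p%:F ^+ n != 0 by rewrite expf_neq0.
have [||N IN] := hD (fun n =>
  @tofrac D @^-1` [set x / p%:F ^+ n * v | v in V]).
- by move=> n; apply: quasi_b_valuation => //; rewrite mulf_neq0 ?invr_eq0.
- move=> n a [v Vv vE]; exists (p%:F * v).
    by apply: overringM => //; exact: overring_frac.
  by rewrite -vE exprSr invfM -!mulrA mulKf.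
have [a [s [Ps s0 xE]]] := VP _ (Vall N.+1).
have /seteqP[IN1 _] := IN N.+1 (leqnSn N).
have [|v Vv] := IN1 a.
  by exists s%:F; [exact: overring_frac|rewrite xE divfK].
have -> : a%:F = x / p%:F ^+ N * (s%:F / p%:F).
  rewrite -[LHS](divfK s0) -xE exprSr invfM -!mulrA; congr (_ * (_ * _)).
  by rewrite mulrC.
move=> /mulfI vE; apply: nVp.
have -> : (p%:F)^-1 = v / s%:F.
  by rewrite vE ?mulf_neq0 ?invr_eq0 // mulrAC divff // mul1r.
by apply: overringM => //; exact: Vinv.
Qed.

(** * Divisorial ideals *)

(** For [y] in [(D : I)] and any valuation overring [V], [y I V <= V]; so [y x]
    is in all valuation overrings whenever [x] is in [I^b], hence in [D]. *)
Lemma divisorial_quasi_b I : integrally_closed D ->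
  divisorial_ideal I -> quasi_b_ideal I.
Proof.
move=> icD [idI I0 Iv]; apply: quasi_b_idealI => // x Ix.
suff [a Ia /eqP] : (@tofrac D @` I) x%:F by rewrite tofrac_eq => /eqP <-.
rewrite -Iv => y Iy; apply: integrally_closed_bigcap => // V vV.
have oV := valuation_overring_overring vV.
have [n [e [t [Ie Vt ->]]]] := Ix V vV; rewrite mulr_suml.
apply: overring_sum => // i; rewrite mulrC mulrA; apply: overringM => //.
by have [a ->] := Iy _ (Ie i); exact: overring_frac.
Qed.

End BNoetherian.

Theorem proposition6 (D : idomainType) (hD : b_noetherian D) :
  [/\ noetherian_space (spec D),
      (forall V : set {fraction D}, valuation_overring V ->
         (forall I : set D, ideal I ->
            principal_ideal V (prodset (@tofrac D @` I) V)) /\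
         (forall E : set {fraction D}, fractional_ideal E ->
            principal_fractional_ideal V (prodset E V))) /\
      (forall V : set {fraction D}, essential_valuation_overring V ->
         V <> [set: {fraction D}] -> rank1_discrete_valuation_domain V)
    & integrally_closed D -> mori D].
Proof.
split; first exact: b_noetherian_spec.
  split=> [V vV|V]; last exact: essential_discrete.
  have oV := valuation_overring_overring vV; split=> [I idI|E fE].
    have [_ [a Ia <-] IaV] :=
      fractional_ideal_dominating hD vV (ideal_fractional idI).
    exists a%:F; first exact: overring_frac.
    by apply: prodset_dominated => //; exists a.
  have [e Ee EeV] := fractional_ideal_dominating hD vV fE.
  by exists e; exact: prodset_dominated.
by move=> icD I divI; apply: hD => n; exact: divisorial_quasi_b.
Qed.
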